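(* There exist sequences $(\epsilon_m)_{m\in\mathbb N}$ and $(r_m)_{m\in\mathbb N}$ such that $(\epsilon_m)$ is a decreasing sequence of positive reals tending to $0$ with $\epsilon_1<1$ and $\sum_{m=1}^\infty\epsilon_m=\infty$, and $(r_m)$ is a strictly increasing sequence with $r_1\ge4$, $r_m^{\epsilon_m}\in\mathbb N$ for all $m\in\mathbb N$, and $r_{k+1}^{\epsilon_{k+1}}\ge e^{r_k}$ for all $k\in\mathbb N$. For any such sequences, the function \[ f(z)=\prod_{m=1}^\infty\left(1-\frac{z}{r_m}\right)^{r_m^{\epsilon_m}} \] is a transcendental entire function of order zero for which there do not exist $R_1>0$, $L>1$ and a sequence $(a_n)_{n\in\mathbb N}$ of positive reals such that all of the following hold: the sequence $(R_n)$ defined by $R_{n+1}=M(R_n)$ tends to $\infty$; for all $n\in\mathbb N$ and all $r\in[R_n,R_{n+1})$ there exists $t\in(r,r^L)$ with \[ \frac{\log m(t)}{\log M(r)}\ge L(1-a_n); \] and $\sum_{n\in\mathbb N}a_n<\infty$.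
   Context: For an entire function $f$ and $r>0$, $M(r)=\max_{|z|=r}|f(z)|$ and $m(r)=\min_{|z|=r}|f(z)|$. The order of $f$ is $\limsup_{r\to\infty}\frac{\log\log M(r)}{\log r}$. $\mathbb N=\{1,2,\dots\}$; $\log 0=-\infty$. *)

(* Defs.v *)
From HB Require Import structures.
From mathcomp Require Import all_boot all_order all_algebra.
From mathcomp Require Import complex.
From mathcomp Require Import all_classical all_reals all_analysis.

Set Implicit Arguments.
Unset Strict Implicit.
Unset Printing Implicit Defensive.

Import Order.TTheory GRing.Theory Num.Theory.
Import numFieldNormedType.Exports.

Local Open Scope classical_set_scope.
Local Open Scope ring_scope.
Local Open Scope complex_scope.

(* Sequences indexed by {1, 2, ...} are rendered as functions on nat, the value at
   m being the term of index m + 1. *)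

(* The topology on the complex numbers is the one carried by R[i]^o, the complex
   numbers as a normed space over themselves: [derivable f z 1] then says that
   (f (z + h) - f z) / h converges as the complex number h tends to 0. *)
Definition entire (R : realType) (f : R[i]^o -> R[i]^o) : Prop :=
  forall z : R[i]^o, derivable f z 1.

(* Convention of complex dynamics and value distribution theory: an entire function is transcendental
   when it is not a polynomial. *)
Definition transcendental_entire (R : realType) (f : R[i]^o -> R[i]^o) : Prop :=
  entire f /\ ~ exists p : {poly R[i]}, forall z : R[i], f z = p.[z].

(* The moduli of f on the circle |z| = r, as real numbers: [normc] is the
   R-valued modulus, whereas `|z| has values in R[i]. *)
Definition circle_moduli (R : realType) (f : R[i]^o -> R[i]^o) (r : R) : set R :=
  [set ComplexField.Normc.normc (f z) | z in
    [set z : R[i] | ComplexField.Normc.normc z = r]].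

(* For f continuous and r >= 0 the circle is compact, so that the supremum and
   the infimum are attained. *)
Definition max_modulus (R : realType) (f : R[i]^o -> R[i]^o) (r : R) : R :=
  sup (circle_moduli f r).

Definition min_modulus (R : realType) (f : R[i]^o -> R[i]^o) (r : R) : R :=
  inf (circle_moduli f r).

(* [lne] is the extended real logarithm, with lne 0 = -oo. *)
Definition growth_order (R : realType) (f : R[i]^o -> R[i]^o) : \bar R :=
  limf_esup
    (fun r : R => (lne (lne (max_modulus f r)%:E) / lne r%:E)%E) (pinfty_nbhs R).

Definition admissible (R : realType) (eps r : nat -> R) : Prop :=
  [/\ [/\ forall m, 0 < eps m,
          forall m, eps m.+1 <= eps m,
          eps @ \oo --> (0 : R),
          eps 0%N < 1
        & (\sum_(0 <= m <oo) (eps m)%:E = +oo)%E]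
    & [/\ forall m, r m < r m.+1,
          4 <= r 0%N,
          forall m, exists2 k : nat, (0 < k)%N & r m `^ eps m = k%:R
        & forall k, expR (r k) <= r k.+1 `^ eps k.+1]].

(* The exponent r_m ^ eps_m is a real number which is a natural number when
   (eps, r) is admissible; [Num.truncn] turns it into an element of nat. *)
Definition partial_product (R : realType) (eps r : nat -> R) (z : R[i]) (n : nat) :
    R[i]^o :=
  \prod_(0 <= m < n) (1 - z / (r m)%:C) ^+ Num.truncn (r m `^ eps m).

Definition infinite_product (R : realType) (eps r : nat -> R) (z : R[i]^o) : R[i]^o :=
  limn (partial_product eps r z).

(* (R_n), with R_1 the given real number and R_(n + 1) = M(R_n). *)
Definition max_modulus_orbit (R : realType) (f : R[i]^o -> R[i]^o) (R1 : R)
    (n : nat) : R :=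
  iter n (max_modulus f) R1.

(* Main.v *)
Require Import Defs.
From mathcomp Require Import all_boot all_order all_algebra.
From mathcomp Require Import complex.
From mathcomp Require Import all_classical all_reals all_analysis.
From mathcomp Require Import ring lra.

Import Order.TTheory GRing.Theory Num.Theory.
Import numFieldNormedType.Exports.

Local Open Scope classical_set_scope.
Local Open Scope ring_scope.

(** Write N_m for the exponent r_m ^ eps_m, and P_n(x) for the product of the
   (1 + x / r_m) ^ N_m over m < n. The maximum of the modulus of the n-th partial
   product on the circle of radius x is P_n(x). Since N_m r_m^-d <= 1 / N_m as soon
   as 2 eps_m <= d, and N_m >= 2 ^ m, the sum of the N_m r_m^-d converges for every
   d > 0; with 1 + y <= exp (p y^(1/p)) this yields P_n(x) <= exp (C_p x^(1/p)) for
   every p >= 1, uniformly in n (majorant_product_le_expR). The case p = 1 gives the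
   convergence of the product, because the increments of the partial products are
   dominated by those of P_n, and the case of large p gives the order zero. The
   limit is entire because the partial products have first-order expansions at
   each point with a remainder bounded by K |h|^2 uniformly in n
   (derivable_limit_quadratic_expansion), and it is not a polynomial because it
   vanishes at every r_m but equals 1 at 0.

   For the last assertion, fix L > 1 and compare the moduli at s = r_k^(1/L), where
   k = j + 1. Let D and B be the sums of the N_m and of the N_m log r_m over m < k.
   Then log M(s) >= D log s - B. For t between s and s^L = r_k the zero at r_k,
   whose multiplicity N_k is at least exp (r_(k-1)), forces
   log m(t) <= D (log r_k + log D - log N_k) - B. Here log N_k = eps_k log r_k, and
   log D and log r_(k-1) are negligible with respect to log N_k, so that the
   quotient log m(t) / log M(s) is at most L (1 - eps_k / 2) for large k
   (modulus_gap). A sequence (a_n) as in the theorem therefore satisfies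
   a_n >= eps_k / 2 for these k when r_k^(1/L) lies in [R_n, R_(n+1)). As M(x) <= exp (C x^(1/2)), while r_(k+1) is at
   least exp (r_k), distinct large k belong to distinct n (orbit_index), and the
   divergence of the sum of the eps_k contradicts the convergence of the sum
   of the a_n. *)

(** * Modulus and convergence of complex sequences *)

Local Notation normc := ComplexField.Normc.normc.

Section ComplexModulus.
Variable R : realType.
Implicit Types (z w : R[i]) (x : R).

Lemma normc_ge0 z : 0 <= normc z.
Proof. by case: z => a b; exact: sqrtr_ge0. Qed.

Lemma normcX z n : normc (z ^+ n) = normc z ^+ n.
Proof.
elim: n => [|n IHn]; first by rewrite !expr0 ComplexField.Normc.normc1.
by rewrite !exprS ComplexField.Normc.normcM IHn.
Qed.

Lemma normc_prod (I : Type) (s : seq I) (F : I -> R[i]) :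
  normc (\prod_(i <- s) F i) = \prod_(i <- s) normc (F i).
Proof.
apply: (big_morph (@ComplexField.Normc.normc R)).
  exact: ComplexField.Normc.normcM.
exact: ComplexField.Normc.normc1.
Qed.

Lemma normc_real x : normc x%:C%C = `|x|.
Proof. by rewrite /= expr0n /= addr0 sqrtr_sqr. Qed.

Lemma normc_nonneg x : 0 <= x -> normc x%:C%C = x.
Proof. by move=> x0; rewrite normc_real ger0_norm. Qed.

Lemma normc_sub z w : normc (z - w) = normc (w - z).
Proof. by rewrite -normcN opprB. Qed.

Lemma normc_Re z : `|complex.Re z| <= normc z.
Proof.
by case: z => a b /=; rewrite -sqrtr_sqr ler_wsqrtr // lerDl sqr_ge0.
Qed.

Lemma normc_Im z : `|complex.Im z| <= normc z.
Proof.
by case: z => a b /=; rewrite -sqrtr_sqr ler_wsqrtr // lerDr sqr_ge0.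
Qed.

Lemma normc_le_ReIm z : normc z <= `|complex.Re z| + `|complex.Im z|.
Proof.
case: z => a b /=; rewrite -[leRHS]ger0_norm ?addr_ge0 // -sqrtr_sqr.
rewrite ler_wsqrtr // sqrrD !real_normK ?num_real //.
by rewrite -addrA lerD2l lerDr mulrn_wge0 // mulr_ge0.
Qed.

Lemma gtc0_real (e : R[i]) : 0 < e -> exists2 d : R, 0 < d & e = d%:C%C.
Proof.
case: e => a b; rewrite ltcE /= => /andP[/eqP -> a0].
by exists a.
Qed.

Lemma near_normc_cvg (T : Type) (F : set_system T) (FF : Filter F)
    (u : T -> R[i]^o) (l : R[i]^o) :
  (forall e : R, 0 < e -> \forall t \near F, normc (l - u t) < e) ->
  u @ F --> l.
Proof.
move=> ul; apply/cvgrPdist_lt => e /gtc0_real[d d0 ->].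
have := ul d d0; apply: filterS => t.
by rewrite -ltcR.
Qed.

Lemma cvg_near_normc (T : Type) (F : set_system T) (FF : Filter F)
    (u : T -> R[i]^o) (l : R[i]^o) (e : R) :
  u @ F --> l -> 0 < e -> \forall t \near F, normc (l - u t) < e.
Proof.
move=> /cvgrPdist_lt ul e0.
have /ul : (0 : R[i]) < e%:C%C by rewrite ltcR.
by apply: filterS => t; rewrite -ltcR.
Qed.

Lemma cvg_normc_le (u : nat -> R[i]^o) (l : R[i]^o) (k : nat) x :
  u @ \oo --> l -> (forall n, (k <= n)%N -> normc (u n) <= x) -> normc l <= x.
Proof.
move=> ul ux; apply/ler_addgt0Pr => e e0.
have [n [kn un]] : exists n, (k <= n)%N /\ normc (l - u n) < e.
  near \oo => n; exists n; split; near: n; first exact: nbhs_infty_ge.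
  exact: cvg_near_normc.
rewrite -(subrK (u n : R[i]) l) addrC; apply: (le_trans (le_normcD _ _)).
by rewrite lerD ?ux // ltW.
Unshelve. all: by end_near. Qed.

Lemma cvg_normc_ge (u : nat -> R[i]^o) (l : R[i]^o) (k : nat) x :
  u @ \oo --> l -> (forall n, (k <= n)%N -> x <= normc (u n)) -> x <= normc l.
Proof.
move=> ul ux; apply/ler_addgt0Pr => e e0.
have [n [kn un]] : exists n, (k <= n)%N /\ normc (l - u n) < e.
  near \oo => n; exists n; split; near: n; first exact: nbhs_infty_ge.
  exact: cvg_near_normc.
apply: (le_trans (ux n kn)).
rewrite -[X in normc X](subrK (l : R[i])) addrC.
apply: (le_trans (le_normcD _ _)); rewrite lerD2l normc_sub.
exact: ltW.
Unshelve. all: by end_near. Qed.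

Lemma ReB z w : complex.Re (z - w) = complex.Re z - complex.Re w.
Proof. by case: z w => ? ? []. Qed.

Lemma ImB z w : complex.Im (z - w) = complex.Im z - complex.Im w.
Proof. by case: z w => ? ? []. Qed.

(** Adding the majorant turns the sequence into a nondecreasing one. *)
Lemma majorized_cvgn (u v : nat -> R) x :
  (forall n, `|u n.+1 - u n| <= v n.+1 - v n) -> (forall n, v n <= x) ->
  cvgn u.
Proof.
move=> uv vx.
have v_incr : nondecreasing_seq v.
  apply/nondecreasing_seqP => n; rewrite -subr_ge0.
  exact: le_trans (normr_ge0 _) (uv n).
have uDv_incr : nondecreasing_seq (u \+ v).
  apply/nondecreasing_seqP => n /=; have := uv n.
  by rewrite ler_norml => /andP[h _]; lra.
have uBv n : u n - v n <= u 0%N - v 0%N.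
  elim: n => // n; have := uv n; rewrite ler_norml => /andP[_ h]; lra.
have -> : u = (u \+ v) \- v by apply/funext => n /=; rewrite addrK.
apply: is_cvgB; apply: nondecreasing_is_cvgn => //.
  exists (u 0%N - v 0%N + x + x) => _ [n _ <-] /=.
  by have := uBv n; have := vx n; lra.
by exists x => _ [n _ <-].
Qed.

(** Completeness of the complex numbers, in the form of the comparison test;
   it follows from that of the reals for the real and imaginary parts. *)
Lemma majorized_cvgn_complex (u : nat -> R[i]^o) (v : nat -> R) x :
  (forall n, normc (u n.+1 - u n) <= v n.+1 - v n) -> (forall n, v n <= x) ->
  cvgn u.
Proof.
move=> uv vx.
have /cvg_ex[a ua] : cvgn (@complex.Re R \o u).
  apply: (@majorized_cvgn _ v x) => // n; rewrite /= -ReB.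
  exact: le_trans (normc_Re _) (uv n).
have /cvg_ex[b ub] : cvgn (@complex.Im R \o u).
  apply: (@majorized_cvgn _ v x) => // n; rewrite /= -ImB.
  exact: le_trans (normc_Im _) (uv n).
apply/cvg_ex; exists (a +i* b)%C; apply: near_normc_cvg => e e0.
have e20 : 0 < e / 2 by rewrite divr_gt0.
near=> n.
apply: (le_lt_trans (normc_le_ReIm _)); rewrite (splitr e) ltrD //.
  have -> : complex.Re ((a +i* b)%C - u n) = a - (@complex.Re R \o u) n.
    exact: ReB.
  near: n; move/cvgrPdist_lt : ua => /(_ _ e20); exact.
have -> : complex.Im ((a +i* b)%C - u n) = b - (@complex.Im R \o u) n.
  exact: ImB.
near: n; move/cvgrPdist_lt : ub => /(_ _ e20); exact.
Unshelve. all: by end_near. Qed.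

End ComplexModulus.

(** * Differentiability of limits with uniform quadratic remainders *)

Section QuadraticExpansion.
Variable R : realType.
Implicit Types (u v f : R[i] -> R[i]) (z w : R[i]) (K : R).

(** The constant bounds the whole expansion, value included, rather than the
   remainder alone: this is what makes the bounds multiply under products. The
   coefficient d does not depend on h. *)
Definition quadratic_expansion u z K :=
  exists d, forall h, normc h <= 1 -> exists e,
    u (z + h) = u z + h * d + h ^+ 2 * e /\
    normc (u z) + normc d + normc e <= K.

Lemma quadratic_expansion_le u z K K' :
  K <= K' -> quadratic_expansion u z K -> quadratic_expansion u z K'.
Proof.
move=> KK' [d ud]; exists d => h /ud[e [-> ue]]; exists e; split => //.
exact: le_trans ue KK'.
Qed.

Lemma quadratic_expansion1 z : quadratic_expansion (fun=> 1) z 1.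
Proof.
exists 0 => h _; exists 0; split; first by rewrite !mulr0 !addr0.
by rewrite ComplexField.Normc.normc1 ComplexField.Normc.normc0 !addr0.
Qed.

Lemma quadratic_expansion_linear_factor w z :
  quadratic_expansion (fun x => 1 - x * w) z (1 + (normc z + 1) * normc w).
Proof.
exists (- w) => h _; exists 0; split.
  by rewrite mulr0 addr0 mulrDl mulrN opprD addrA.
rewrite ComplexField.Normc.normc0 addr0 normcN mulrDl mul1r addrA lerD2r.
apply: (le_trans (le_normcD _ _)).
by rewrite normcN ComplexField.Normc.normcM ComplexField.Normc.normc1.
Qed.

Lemma quadratic_expansionM u v z K K' :
  quadratic_expansion u z K -> quadratic_expansion v z K' ->
  quadratic_expansion (fun x => u x * v x) z (K * K').
Proof.
move=> [d ud] [d' vd']; exists (u z * d' + d * v z) => h h1.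
have [e [-> ue]] := ud h h1; have [e' [-> ve']] := vd' h h1.
exists (u z * e' + d * d' + e * v z + h * (d * e' + e * d') +
        h ^+ 2 * (e * e')); split; first by ring.
have nD := @le_normcD R.
have nM := @ComplexField.Normc.normcM R.
have n0 := @normc_ge0 R.
apply: le_trans (ler_pM _ _ ue ve'); rewrite ?addr_ge0 //.
have h_le x : normc (h * x) <= normc x by rewrite nM ler_piMl.
have h2_le x : normc (h ^+ 2 * x) <= normc x.
  by rewrite nM normcX ler_piMl // exprn_ile1.
have -> : (normc (u z) + normc d + normc e) *
          (normc (v z) + normc d' + normc e') =
   normc (u z) * normc (v z) +
   (normc (u z) * normc d' + normc d * normc (v z)) +
   (normc (u z) * normc e' + normc d * normc d' + normc e * normc (v z) +
    (normc d * normc e' + normc e * normc d') + normc e * normc e') by ring.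
rewrite -!nM; do ![apply: lerD => //]; apply: (le_trans (nD _ _)) => //.
apply: lerD; last exact: h2_le.
apply: (le_trans (nD _ _)); apply: lerD.
  apply: (le_trans (nD _ _)); apply: lerD => //; exact: nD.
by apply: (le_trans (h_le _)); exact: nD.
Qed.

Lemma quadratic_expansionX u z K n : quadratic_expansion u z K ->
  quadratic_expansion (fun x => u x ^+ n) z (K ^+ n).
Proof.
move=> uK; elim: n => [|n IHn]; first exact: quadratic_expansion1.
rewrite exprS (_ : (fun x => _) = (fun x => u x * u x ^+ n)).
  exact: quadratic_expansionM.
by apply/funext => x; rewrite exprS.
Qed.

Lemma quadratic_expansion_prod (F : nat -> R[i] -> R[i]) (K : nat -> R) z n :
  (forall m, quadratic_expansion (F m) z (K m)) ->
  quadratic_expansion (fun x => \prod_(0 <= m < n) F m x) z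
    (\prod_(0 <= m < n) K m).
Proof.
move=> FK; elim: n => [|n IHn].
  rewrite big_nil (_ : (fun x => _) = fun=> 1); last first.
    by apply/funext => x; rewrite big_nil.
  exact: quadratic_expansion1.
rewrite big_nat_recr //= (_ : (fun x => _) =
    (fun x => (\prod_(0 <= m < n) F m x) * F n x)); last first.
  by apply/funext => x; rewrite big_nat_recr.
exact: quadratic_expansionM.
Qed.

(** The difference quotients at h and h' of each member of the sequence differ
   by at most K (|h| + |h'|), because their common term d cancels. This bound
   survives the pointwise limit, and it makes the quotients of the limit
   converge as h tends to 0. *)
Lemma derivable_limit_quadratic_expansion (u : nat -> R[i] -> R[i]^o)
    (f : R[i]^o -> R[i]^o) z K :
  (forall x, u n x @[n --> \oo] --> f x) ->
  (forall n, quadratic_expansion (u n) z K) ->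
  derivable f z 1.
Proof.
move=> uf uK.
pose q (g : R[i]^o -> R[i]^o) (h : R[i]) : R[i]^o := h^-1 * (g (h + z) - g z).
have K0 : 0 <= K.
  have [d /(_ 0)] := uK 0%N; rewrite ComplexField.Normc.normc0.
  move=> /(_ ler01)[e [_]]; apply: le_trans.
  by rewrite !addr_ge0 ?normc_ge0.
have q_cvg h : q (u n) h @[n --> \oo] --> q f h.
  by apply: cvgMr; apply: cvgB.
have q_lip h h' : h != 0 -> h' != 0 -> normc h <= 1 -> normc h' <= 1 ->
    normc (q f h - q f h') <= K * (normc h + normc h').
  move=> h0 h'0 h1 h'1.
  have qq : (q (u n) h - q (u n) h') @[n --> \oo] --> q f h - q f h'.
    exact: cvgB.
  apply: (@cvg_normc_le _ _ _ 0%N _ qq) => n _ /=.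
  have [d ud] := uK n.
  have [e [ue eK]] := ud h h1; have [e' [ue' eK']] := ud h' h'1.
  have -> : q (u n) h - q (u n) h' = h * e - h' * e'.
    rewrite /q ![_ + z]addrC ue ue'.
    by field; rewrite h0 h'0.
  apply: (le_trans (le_normcD _ _)).
  rewrite normcN !ComplexField.Normc.normcM mulrDr !(mulrC K).
  have eleK x y (c : R) : normc x + normc y + c <= K -> c <= K.
    by apply: le_trans; rewrite lerDr addr_ge0 ?normc_ge0.
  by apply: lerD; apply: ler_wpM2l; rewrite ?normc_ge0 ?(eleK _ _ _ eK)
    ?(eleK _ _ _ eK').
pose hn n : R[i] := (2^-1 ^+ n)%:C%C.
have hn_norm n : normc (hn n) = 2^-1 ^+ n.
  by rewrite normc_real ger0_norm // exprn_ge0.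
have hn_le1 n : normc (hn n) <= 1.
  by rewrite hn_norm exprn_ile1 // invf_le1 // ler1n.
have hn_neq0 n : hn n != 0.
  by rewrite -(rmorph0 (real_complex R)) (inj_eq (@complexI R)) expf_neq0.
have /cvg_ex[g qg] : cvgn (fun n => q f (hn n)).
  apply: (@majorized_cvgn_complex _ _ (fun n => - (3 * K * 2^-1 ^+ n)) 0).
    move=> n; apply: (le_trans (q_lip _ _ _ _ _ _)) => //.
    by rewrite !hn_norm exprS; lra.
  by move=> n; rewrite oppr_le0 !mulr_ge0 // exprn_ge0.
suff q_g : q f h @[h --> (0 : R[i]^o)^'] --> g.
  apply/cvg_ex; exists g; apply: cvg_trans q_g; apply: near_eq_cvg.
  near=> h; rewrite /q /= [h *: 1]mulr1; reflexivity.
apply: near_normc_cvg => e e0.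
pose d := Num.min 1 (e / (4 * (K + 1))).
have d0 : 0 < d.
  by rewrite lt_min ltr01 divr_gt0 // mulr_gt0 // ltr_wpDl.
have Kd : K * d <= e / 4.
  have -> : e / 4 = (K + 1) * (e / (4 * (K + 1))).
    by field; rewrite gt_eqF // ltr_wpDl.
  apply: ler_pM => //; [exact: ltW | by rewrite lerDl | by rewrite ge_min lexx orbT].
near=> h.
have h0 : h != 0 by near: h; exact: (nbhs_dnbhs_neq (0 : R[i]^o)).
have hd : normc h < d.
  near: h.
  have : \forall h \near (0 : R[i]^o)^', `|h| < d%:C%C.
    by apply: dnbhs0_lt; rewrite ltcR.
  by apply: filterS => x; rewrite -ltcR.
have [n [hnd qn]] : exists n, normc (hn n) < d /\ normc (g - q f (hn n)) < e / 4.
  near \oo => n; exists n; split; near: n.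
    have : (2^-1 : R) ^+ n @[n --> \oo] --> (0 : R).
      by apply: cvg_expr; rewrite ger0_norm // invf_lt1 // ltr1n.
    move/cvgrPdist_lt => /(_ _ d0); apply: filterS => n.
    by rewrite sub0r normrN hn_norm ger0_norm // exprn_ge0.
  by apply: cvg_near_normc => //; rewrite divr_gt0.
rewrite -(subrK (q f (hn n) : R[i]) g) -addrA.
apply: (le_lt_trans (le_normcD _ _)).
have d1 : d <= 1 by rewrite ge_min lexx.
have := q_lip (hn n) h (hn_neq0 n) h0 (hn_le1 n) (le_trans (ltW hd) d1).
have : K * (normc (hn n) + normc h) <= K * d + K * d.
  by rewrite mulrDr lerD // ler_wpM2l // ltW.
move: qn Kd; lra.
Unshelve. all: by end_near. Qed.

End QuadraticExpansion.

(** * Admissible sequences and the majorant product *)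

Lemma ler1DXn (R : realDomainType) (x : R) n :
  (0 < n)%N -> 0 <= x -> 1 + x ^+ n <= (1 + x) ^+ n.
Proof.
case: n => // n _ x0; elim: n => [|n IHn]; first by rewrite !expr1.
rewrite exprS [leRHS]exprS.
have xn0 : 0 <= x ^+ n.+1 by rewrite exprn_ge0.
apply: (@le_trans _ _ ((1 + x) * (1 + x ^+ n.+1))); last first.
  by rewrite ler_wpM2l // addr_ge0.
by rewrite mulrDl mul1r mulrDr mulr1; lra.
Qed.

(** Because ln x = 2 ln (sqrt x) <= 2 sqrt x. *)
Lemma linear_ln_le_id (R : realType) (c x : R) :
  0 < c -> (2 * c) ^+ 2 <= x -> c * ln x <= x.
Proof.
move=> c0 cx; have x0 : 0 < x by apply: lt_le_trans cx; rewrite exprn_gt0 // mulr_gt0.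
have y0 : 0 < Num.sqrt x by rewrite sqrtr_gt0.
have cy : 2 * c <= Num.sqrt x.
  rewrite -[leLHS]ger0_norm; last by rewrite mulr_ge0 // ltW.
  by rewrite -sqrtr_sqr ler_wsqrtr.
have xE : x = Num.sqrt x ^+ 2 by rewrite sqr_sqrtr // ltW.
have lnx : ln x <= 2 * Num.sqrt x.
  rewrite [in ln x]xE lnXn // -[_ *+ 2]mulr_natl ler_pM2l //.
  exact/ltW/ln_sublinear.
apply: (@le_trans _ _ (c * (2 * Num.sqrt x))); first by rewrite ler_pM2l.
by rewrite mulrA [c * 2]mulrC [leRHS]xE expr2 ler_pM2r.
Qed.

Section AdmissibleSequences.
Variables (R : realType) (eps r : nat -> R).
Hypothesis adm : admissible eps r.

Let N m := Num.truncn (r m `^ eps m).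

Lemma admissible_eps_gt0 m : 0 < eps m.
Proof. by case: adm => -[]. Qed.

Lemma admissible_eps_lt1 m : eps m < 1.
Proof.
case: adm => -[_ eps_decr _ eps0 _] _.
by elim: m => // m; apply: le_lt_trans.
Qed.

Lemma admissible_r_incr m n : (m <= n)%N -> r m <= r n.
Proof.
case: adm => _ [r_incr _ _ _].
by move: m n; apply/nondecreasing_seqP => n; exact: ltW.
Qed.

Lemma admissible_r_ge4 m : 4 <= r m.
Proof.
by case: adm => _ [_ r0 _ _]; apply: le_trans r0 (admissible_r_incr _ _ _).
Qed.

Lemma admissible_r_ge1 m : 1 <= r m.
Proof. by have := admissible_r_ge4 m; lra. Qed.

Lemma admissible_r_gt0 m : 0 < r m.
Proof. by have := admissible_r_ge4 m; lra. Qed.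

Lemma exponentE m : r m `^ eps m = (N m)%:R.
Proof.
by case: adm => _ [_ _ /(_ m)[k _ rk] _]; rewrite /N rk natrK.
Qed.

Lemma exponent_gt0 m : (0 < N m)%N.
Proof. by rewrite -(ltr_nat R) -exponentE powR_gt0 ?admissible_r_gt0. Qed.

Lemma exponent_le_r m : (N m)%:R <= r m.
Proof.
by rewrite -exponentE ler1_powR ?admissible_r_ge1 // ltW ?admissible_eps_lt1.
Qed.

Lemma expR_r_le_exponent m : expR (r m) <= (N m.+1)%:R.
Proof. by case: adm => _ [_ _ _ /(_ m)]; rewrite exponentE. Qed.

Lemma r_le_ln_exponent m : r m <= ln (N m.+1)%:R.
Proof.
by rewrite -ler_expR lnK ?posrE ?ltr0n ?exponent_gt0 // expR_r_le_exponent.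
Qed.

Lemma ln_exponent m : ln (N m)%:R = eps m * ln (r m).
Proof. by rewrite -exponentE ln_powR. Qed.

(** Because exp x >= 2 x for x >= 4, and r_m >= N_m. *)
Lemma exponent_ge_exp2 m : 2 ^+ m <= (N m)%:R :> R.
Proof.
elim: m => [|m IHm]; first by rewrite expr0 ler1n exponent_gt0.
apply: le_trans (expR_r_le_exponent m); rewrite exprS.
have /le_trans : 2 * (2 ^+ m) <= 2 * r m :> R.
  by rewrite ler_pM2l // (le_trans IHm) ?exponent_le_r.
apply; have := admissible_r_ge4 m; move: (r m) => x x4.
have -> : expR x = expR (x / 2) ^+ 2.
  by rewrite -expRM_natl; congr expR; field.
have := expR_ge1Dx (x / 2); nra.
Qed.

Lemma admissible_r_ge_nat m : m.+1%:R <= r m.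
Proof.
elim: m => [|m IHm]; first by have := admissible_r_ge4 0; lra.
have := expR_ge1Dx (r m); have := expR_r_le_exponent m.
have := exponent_le_r m.+1; rewrite -[m.+2%:R]natr1; lra.
Qed.

(** As r_m^-d is at most N_m^-2 once 2 eps_m <= d, the terms of this sum are
   eventually at most 1 / N_m. *)
Lemma bounded_exponent_sum d : 0 < d ->
  exists B, forall n, \sum_(0 <= m < n) (N m)%:R * r m `^ (- d) <= B.
Proof.
move=> d0; pose T m : R := (N m)%:R * r m `^ (- d).
have [m0 m0P] : exists m0, forall m, (m0 <= m)%N -> T m <= 2^-1 ^+ m.
  have eps0 : eps @ \oo --> (0 : R) by case: adm => -[].
  have d20 : 0 < d / 2 by rewrite divr_gt0.
  have [m0 _ m0P] := (cvgrPdist_lt _ _).1 eps0 _ d20.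
  exists m0 => m /m0P /=; rewrite sub0r normrN gtr0_norm ?admissible_eps_gt0 //.
  move=> epsd; apply: (@le_trans _ _ (N m)%:R^-1).
    rewrite -exponentE -powRN /T -exponentE -powRD; last first.
      by rewrite (gt_eqF (admissible_r_gt0 m)) implybT.
    by apply: ler_powR; [exact: admissible_r_ge1 | lra].
  by rewrite exprVn lef_pV2 ?posrE ?exprn_gt0 ?ltr0n ?exponent_gt0 //
    exponent_ge_exp2.
have T0 m : 0 <= T m by rewrite mulr_ge0 ?powR_ge0.
exists (\sum_(0 <= m < m0) T m + 2) => n.
have tail k : \sum_(0 <= m < m0 + k) T m <=
    \sum_(0 <= m < m0) T m + (2 - 2 * 2^-1 ^+ k).
  elim: k => [|k IHk]; first by rewrite addn0 expr0; lra.
  rewrite addnS big_nat_recr //= exprS.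
  have : T (m0 + k)%N <= 2^-1 ^+ k.
    apply: (le_trans (m0P _ (leq_addr _ _))).
    by rewrite ler_wiXn2l ?leq_addl // invf_le1 // ler1n.
  by move: IHk; lra.
apply: (@le_trans _ _ (\sum_(0 <= m < m0 + n) T m)).
  by rewrite (big_cat_nat (leq0n n) (leq_addl m0 n)) /= lerDl sumr_ge0.
apply: (le_trans (tail n)).
by have : (0 : R) <= 2^-1 ^+ n by [rewrite exprn_ge0]; lra.
Qed.

End AdmissibleSequences.

Section MajorantProduct.
Variables (R : realType) (eps r : nat -> R).
Hypothesis adm : admissible eps r.

Let N m := Num.truncn (r m `^ eps m).

(** The maximum of the modulus of the partial product on the circle of radius
   x, reached at - x. *)
Definition majorant_product (x : R) n :=
  \prod_(0 <= m < n) (1 + x / r m) ^+ N m.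

Local Notation r_gt0 := (admissible_r_gt0 _ _ _ adm).

Lemma majorant_factor_ge1 x m : 0 <= x -> 1 <= (1 + x / r m) ^+ N m.
Proof. by move=> x0; rewrite exprn_ege1 // lerDl divr_ge0 // ltW ?r_gt0. Qed.

Lemma majorant_product_ge1 x n : 0 <= x -> 1 <= majorant_product x n.
Proof.
move=> x0; rewrite /majorant_product; elim/big_ind: _ => // [a b a1 b1|m _].
  by rewrite mulr_ege1.
exact: majorant_factor_ge1.
Qed.

Lemma majorant_product_incr x m n :
  0 <= x -> (m <= n)%N -> majorant_product x m <= majorant_product x n.
Proof.
move=> x0; move: m n; apply/nondecreasing_seqP => n.
rewrite /majorant_product big_nat_recr //= ler_peMr ?majorant_factor_ge1 //.
by apply: le_trans (majorant_product_ge1 _ n x0).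
Qed.

(** By the binomial theorem (1 + y) <= (1 + y^(1/p))^p, so that each factor is
   at most exp (p (x / r_m)^(1/p)). The additional 1 in the constant only makes it
   positive. *)
Lemma majorant_product_le_expR p : (0 < p)%N ->
  exists2 C, 0 < C & forall n x, 0 <= x ->
    majorant_product x n <= expR (C * x `^ p%:R^-1).
Proof.
move=> p0; have [B BP] : exists B, forall n,
    \sum_(0 <= m < n) (N m)%:R * r m `^ (- p%:R^-1) <= B.
  by apply: (bounded_exponent_sum _ _ _ adm); rewrite invr_gt0 ltr0n.
have B0 : 0 <= B by have := BP 0%N; rewrite big_nil.
exists (p%:R * B + 1) => [|n x x0]; first by rewrite ltr_wpDl ?mulr_ge0.
have factor_le y : 0 <= y -> 1 + y <= expR (p%:R * y `^ p%:R^-1).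
  move=> y0; set w := y `^ _.
  have -> : y = w ^+ p.
    by rewrite -powR_mulrn ?powR_ge0 // -powRrM mulVf ?powRr1 // pnatr_eq0 -lt0n.
  have w0 : 0 <= w by exact: powR_ge0.
  rewrite expRM_natl; apply: (@le_trans _ _ ((1 + w) ^+ p)).
    exact: ler1DXn.
  by rewrite lerXn2r ?nnegrE ?addr_ge0 ?expR_ge0 ?expR_ge1Dx.
have -> : expR ((p%:R * B + 1) * x `^ p%:R^-1) =
    expR (p%:R * x `^ p%:R^-1 * B) * expR (x `^ p%:R^-1).
  by rewrite -expRD; congr expR; ring.
apply: (@le_trans _ _ (expR (p%:R * x `^ p%:R^-1 * B))); last first.
  rewrite ler_peMr ?expR_ge0 //; apply: le_trans (expR_ge1Dx _).
  by rewrite lerDl powR_ge0.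
apply: (@le_trans _ _ (expR (p%:R * x `^ p%:R^-1 *
    \sum_(0 <= m < n) (N m)%:R * r m `^ (- p%:R^-1)))); last first.
  by rewrite ler_expR ler_wpM2l ?mulr_ge0 ?powR_ge0.
rewrite mulr_sumr expR_sum; apply: ler_prod => m _.
have xr0 : 0 <= x / r m by rewrite divr_ge0 // ltW ?r_gt0.
apply/andP; split; first by rewrite exprn_ge0 // addr_ge0.
have -> : p%:R * x `^ p%:R^-1 * ((N m)%:R * r m `^ (- p%:R^-1)) =
    (N m)%:R * (p%:R * (x / r m) `^ p%:R^-1).
  rewrite powRM ?invr_ge0 // ?ltW ?r_gt0 //.
  rewrite -[(r m)^-1]powR_inv1 ?ltW ?r_gt0 // -powRrM mulN1r; ring.
by rewrite expRM_natl lerXn2r ?nnegrE ?expR_ge0 ?addr_ge0 ?factor_le.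
Qed.

End MajorantProduct.

(** * The infinite product *)

Section InfiniteProduct.
Variables (R : realType) (eps r : nat -> R).
Hypothesis adm : admissible eps r.

Let N m := Num.truncn (r m `^ eps m).
Let f := infinite_product eps r.
Let r_gt0 m : 0 < r m := admissible_r_gt0 _ _ _ adm m.

Lemma partial_productS z n :
  partial_product eps r z n.+1 =
  partial_product eps r z n * (1 - z / (r n)%:C%C) ^+ N n.
Proof. by rewrite /partial_product big_nat_recr. Qed.

Lemma normc_div_r z m : normc (z / (r m)%:C%C) = normc z / r m.
Proof.
rewrite ComplexField.Normc.normcM ComplexField.Normc.normcV.
by rewrite normc_nonneg // ltW.
Qed.

Lemma normc_partial_product z n :
  normc (partial_product eps r z n) =
  \prod_(0 <= m < n) normc (1 - z / (r m)%:C%C) ^+ N m.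
Proof.
by rewrite /partial_product normc_prod; apply: eq_bigr => m _; rewrite normcX.
Qed.

Lemma normc_partial_product_le z n :
  normc (partial_product eps r z n) <= majorant_product R eps r (normc z) n.
Proof.
rewrite normc_partial_product; apply: ler_prod => m _.
rewrite exprn_ge0 ?normc_ge0 //= lerXn2r ?nnegrE ?normc_ge0 //.
  by rewrite addr_ge0 // divr_ge0 ?normc_ge0 // ltW.
apply: (le_trans (le_normcD _ _)).
by rewrite normcN normc_div_r ComplexField.Normc.normc1.
Qed.

Lemma normc_expB1_le (w : R[i]) n :
  normc ((1 - w) ^+ n - 1) <= (1 + normc w) ^+ n - 1.
Proof.
elim: n => [|n IHn]; first by rewrite !expr0 !subrr ComplexField.Normc.normc0.
have -> : (1 - w) ^+ n.+1 - 1 = ((1 - w) ^+ n - 1) + - w * (1 - w) ^+ n.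
  by rewrite exprS; ring.
apply: (le_trans (le_normcD _ _)).
rewrite ComplexField.Normc.normcM normcN normcX exprS mulrDl mul1r addrAC.
apply: lerD => //; apply: ler_wpM2l; first exact: normc_ge0.
rewrite lerXn2r ?nnegrE ?addr_ge0 ?normc_ge0 //.
apply: (le_trans (le_normcD _ _)).
by rewrite normcN ComplexField.Normc.normc1.
Qed.

(** The increments of the majorants dominate those of the partial products. *)
Lemma partial_product_cvg z : cvgn (partial_product eps r z).
Proof.
have [//|C _ CP] := majorant_product_le_expR _ _ _ adm 1.
apply: (@majorized_cvgn_complex _ _ (majorant_product R eps r (normc z))
  (expR (C * normc z `^ 1%:R^-1))) => n; last by rewrite CP ?normc_ge0.
rewrite partial_productS /majorant_product big_nat_recr //=.
rewrite -/(majorant_product R eps r (normc z) n).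
set P := partial_product eps r z n; set M := majorant_product R eps r _ n.
have -> a : P * a - P = P * (a - 1) by rewrite mulrBr mulr1.
have -> a : M * a - M = M * (a - 1) by rewrite mulrBr mulr1.
rewrite ComplexField.Normc.normcM.
apply: ler_pM; rewrite ?normc_ge0 ?normc_partial_product_le //.
by rewrite -normc_div_r normc_expB1_le.
Qed.

Lemma infinite_product_cvg z :
  partial_product eps r z n @[n --> \oo] --> f z.
Proof. exact: partial_product_cvg. Qed.

Lemma infinite_product_entire : entire f.
Proof.
move=> z; have [//|C _ CP] := majorant_product_le_expR _ _ _ adm 1.
pose x := normc z + 1; have x0 : 0 <= x by rewrite addr_ge0 ?normc_ge0.
apply: (@derivable_limit_quadratic_expansion _
  (fun n w => partial_product eps r w n) _ _ (expR (C * x `^ 1%:R^-1))).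
  exact: infinite_product_cvg.
move=> n; apply: (quadratic_expansion_le _ _ _ _ _ (CP n x x0)).
apply: quadratic_expansion_prod => m; apply: quadratic_expansionX.
have -> : x / r m = (normc z + 1) * normc (r m)%:C%C^-1.
  by rewrite ComplexField.Normc.normcV normc_nonneg // ltW.
exact: quadratic_expansion_linear_factor.
Qed.

Lemma infinite_product_root m : f (r m)%:C%C = 0.
Proof.
apply: ComplexField.Normc.eq0_normc; apply/eqP.
rewrite eq_le normc_ge0 andbT.
apply: (cvg_normc_le _ _ _ m.+1 _ (infinite_product_cvg _)) => n mn.
rewrite normc_partial_product (bigD1_seq m) ?mem_index_iota ?iota_uniq //.
have r_neq0 : (r m)%:C%C != 0 :> R[i].
  by rewrite -(rmorph0 (real_complex R)) (inj_eq (@complexI R)) gt_eqF.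
have -> : normc (1 - (r m)%:C%C / (r m)%:C%C) = 0.
  by rewrite (divff r_neq0) subrr ComplexField.Normc.normc0.
by rewrite expr0n (gtn_eqF (exponent_gt0 _ _ _ adm m)) /= mul0r.
Qed.

Lemma infinite_product0 : f 0 = 1.
Proof.
apply: (cvg_lim (@norm_hausdorff _ _)) => //.
rewrite (_ : partial_product eps r 0 = fun=> 1); first exact: cvg_cst.
apply/funext => n; rewrite /partial_product big1 // => m _.
by rewrite mul0r subr0 expr1n.
Qed.

(** A nonzero polynomial vanishes at fewer points than its size, whereas the
   limit vanishes at every r_m and takes the value 1 at 0. *)
Lemma infinite_product_transcendental : transcendental_entire f.
Proof.
split; first exact: infinite_product_entire.
move=> [p fp]; have p0 : p != 0.
  apply/eqP => p0; have := infinite_product0.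
  by rewrite fp p0 horner0 => /eqP; rewrite eq_sym oner_eq0.
pose s := [seq (r m)%:C%C | m <- iota 0 (size p)].
have /(max_poly_roots p0) : all (root p) s.
  apply/allP => _ /mapP[m _ ->].
  by rewrite rootE -fp infinite_product_root.
have s_uniq : uniq s.
  rewrite map_inj_uniq ?iota_uniq // => m n /complexI rmn.
  have /increasing_seqP r_incr : forall k, r k < r k.+1.
    by case: adm => _ [].
  by apply/eqP; rewrite eqn_leq -!r_incr rmn lexx.
by rewrite s_uniq size_map size_iota ltnn => /(_ isT).
Qed.

Lemma min_modulus_le (t : R) :
  0 <= t -> min_modulus f t <= normc (f t%:C%C).
Proof.
move=> t0; apply: ge_inf.
  by exists 0 => _ [z _ <-]; exact: normc_ge0.
by exists t%:C%C => //; exact: normc_nonneg.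
Qed.

Lemma max_modulus_le p : (0 < p)%N ->
  exists2 C, 0 < C & forall x, 0 <= x ->
    max_modulus f x <= expR (C * x `^ p%:R^-1).
Proof.
move=> p0; have [C C0 CP] := majorant_product_le_expR _ _ _ adm _ p0.
exists C => // x x0; apply: ge_sup.
  by exists (normc (f x%:C%C)), x%:C%C => //; exact: normc_nonneg.
move=> _ [z /= zx <-].
apply: (cvg_normc_le _ _ _ 0%N _ (infinite_product_cvg _)) => n _.
by apply: (le_trans (normc_partial_product_le _ _)); rewrite zx CP.
Qed.

Lemma max_modulus_ge x n : 0 <= x ->
  majorant_product R eps r x n <= max_modulus f x.
Proof.
move=> x0; have [//|C _ CP] := majorant_product_le_expR _ _ _ adm 1.
have xN : normc (- x%:C%C) = x by rewrite normcN normc_nonneg.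
apply: (@le_trans _ _ (normc (f (- x%:C%C)))); last first.
  apply: ub_le_sup; last by exists (- x%:C%C).
  exists (expR (C * x `^ 1%:R^-1)) => _ [z /= zx <-].
  apply: (cvg_normc_le _ _ _ 0%N _ (infinite_product_cvg _)) => k _.
  by apply: (le_trans (normc_partial_product_le _ _)); rewrite zx CP.
apply: (cvg_normc_ge _ _ _ n _ (infinite_product_cvg _)) => k nk.
apply: (le_trans (majorant_product_incr _ _ _ adm _ _ _ x0 nk)).
rewrite normc_partial_product; apply: ler_prod => m _.
have xr0 : 0 <= 1 + x / r m by rewrite addr_ge0 // divr_ge0 // ltW.
apply/andP; split; first by rewrite exprn_ge0.
rewrite mulNr opprK.
have -> : 1 + x%:C%C / (r m)%:C%C = (1 + x / r m)%:C%C.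
  by rewrite rmorphD rmorphM fmorphV rmorph1.
by rewrite normc_nonneg.
Qed.

End InfiniteProduct.

(** * Series of nonnegative terms and existence of admissible sequences *)

Section NonnegativeSeries.
Variables (R : realType) (a : nat -> R).
Hypothesis a_ge0 : forall n, 0 <= a n.

Lemma nneseries_bounded :
  (\sum_(0 <= n <oo) (a n)%:E < +oo)%E ->
  exists A, forall n, \sum_(0 <= m < n) a m <= A.
Proof.
move=> afin; exists (fine (\sum_(0 <= n <oo) (a n)%:E)%E) => n.
rewrite -lee_fin fineK; last first.
  by rewrite ge0_fin_numE // nneseries_ge0 // => i _ _; rewrite lee_fin.
rewrite -sumEFin; apply: nneseries_lim_ge => i _ _.
by rewrite lee_fin.
Qed.

Lemma nneseries_unbounded :
  (\sum_(0 <= n <oo) (a n)%:E = +oo)%E <->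
  ~ exists A, forall n, \sum_(0 <= m < n) a m <= A.
Proof.
split=> [aoo [A aA]|aA].
  suff : (\sum_(0 <= n <oo) (a n)%:E <= A%:E)%E by rewrite aoo.
  apply: lime_le; first by apply: is_cvg_nneseries => i _ _; rewrite lee_fin.
  by apply: nearW => n; rewrite sumEFin lee_fin.
apply/eqP; rewrite -leye_eq leNgt; apply/negP => afin.
exact/aA/nneseries_bounded.
Qed.

Lemma sum_subsequence_le (nu : nat -> nat) n :
  (forall k, (nu k < nu k.+1)%N) ->
  \sum_(0 <= k < n) a (nu k) <= \sum_(0 <= m < nu n) a m.
Proof.
move=> nu_incr; elim: n => [|n IHn]; first by rewrite big_nil sumr_ge0.
rewrite big_nat_recr //=.
apply: (@le_trans _ _ (\sum_(0 <= m < (nu n).+1) a m)).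
  by rewrite big_nat_recr //= lerD2r.
by rewrite (big_cat_nat (leq0n _) (nu_incr n)) /= lerDl sumr_ge0.
Qed.

End NonnegativeSeries.

Section Existence.
Variable R : realType.

(** With eps_m = 1 / (m + 2), the power r_m ^ eps_m is the base of the power below;
   this base exceeds exp (r_(m - 1)). *)
Fixpoint tower_radii m : R :=
  if m is m'.+1 then
    ((Num.truncn (expR (tower_radii m'))).+1%:R) ^+ m'.+3
  else 4.

Lemma tower_radii_root m : exists2 k : nat,
  (0 < k)%N & tower_radii m = k%:R ^+ m.+2.
Proof.
case: m => [|m]; first by exists 2%N => //=; rewrite expr2; lra.
by exists (Num.truncn (expR (tower_radii m))).+1.
Qed.

Lemma powR_root_exp (k m : nat) : (k%:R ^+ m.+2) `^ (m.+2%:R^-1) = k%:R :> R.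
Proof. by rewrite -powR_mulrn // -powRrM divff ?powRr1 // pnatr_eq0. Qed.

Lemma harmonic_tail_dvg :
  ~ exists A : R, forall n, \sum_(0 <= m < n) (m.+2%:R^-1 : R) <= A.
Proof.
move=> [A hA]; apply: (@dvg_harmonic R); apply: nondecreasing_is_cvgn.
  by apply: nondecreasing_series => n _ _; exact: harmonic_ge0.
exists (A + 1) => _ [n _ <-]; rewrite /series /=.
apply: (@le_trans _ _ (\sum_(0 <= k < n.+1) k.+1%:R^-1)).
  by rewrite [leRHS]big_nat_recr //= lerDl invr_ge0.
by rewrite big_nat_recl // invr1 addrC lerD2r.
Qed.

Lemma admissible_exists : exists eps r : nat -> R, admissible eps r.
Proof.
exists (fun m => m.+2%:R^-1), tower_radii.
have rootE m x : x = tower_radii m ->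
    tower_radii m.+1 `^ m.+3%:R^-1 = (Num.truncn (expR x)).+1%:R.
  by move=> -> /=; rewrite powR_root_exp.
split; split.
- by move=> m; rewrite invr_gt0.
- by move=> m; rewrite lef_pV2 ?posrE // ler_nat.
- by have := @cvg_harmonic R; rewrite -(cvg_shiftS).
- by rewrite invf_lt1 // ltr1n.
- by apply/nneseries_unbounded; [move=> n; rewrite invr_ge0 | exact: harmonic_tail_dvg].
- move=> m /=; apply: (@lt_le_trans _ _ (Num.truncn (expR (tower_radii m))).+1%:R).
    apply: lt_trans (truncnS_gt _); apply: lt_le_trans (expR_ge1Dx _).
    by rewrite ltrDr.
  by rewrite ler_eXnr // ler1n.
- by [].
- move=> m; have [k k0 ->] := tower_radii_root m.
  by exists k => //; rewrite powR_root_exp.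
- by move=> k; rewrite (rootE k _ erefl) ltW // truncnS_gt.
Qed.

End Existence.

(** * Order of growth *)

Section GrowthOrder.
Variables (R : realType) (eps r : nat -> R).
Hypothesis adm : admissible eps r.

Let f := infinite_product eps r.

Lemma max_modulus_ge_linear x : 0 <= x -> 1 + x / r 0%N <= max_modulus f x.
Proof.
move=> x0; apply: le_trans (max_modulus_ge _ _ _ adm _ 1 x0).
rewrite /majorant_product big_nat1 ler_eXnr ?(exponent_gt0 _ _ _ adm) //.
by rewrite lerDl divr_ge0 // ltW // (admissible_r_gt0 _ _ _ adm).
Qed.

Lemma dive_posE (x : \bar R) y : 0 < y -> (x / y%:E = x * y^-1%:E)%E.
Proof. by move=> y0; rewrite inver gt_eqF. Qed.

(** Beyond this radius log M(x) > 1, so that the iterated logarithm is finite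
   and positive. *)
Lemma growth_ratioE x : r 0%N * expR 1 <= x ->
  [/\ 0 < ln x, 1 < ln (max_modulus f x) &
   (lne (lne (max_modulus f x)%:E) / lne x%:E)%E =
   (ln (ln (max_modulus f x)) / ln x)%:E].
Proof.
move=> rx; have r4 := admissible_r_ge4 _ _ _ adm 0.
have e1 := expR_ge1Dx (1 : R).
have x1 : 1 < x by apply: lt_le_trans rx; nra.
have x0 : 0 < x by rewrite (lt_trans ltr01).
have M1 : expR 1 < max_modulus f x.
  apply: lt_le_trans (max_modulus_ge_linear _ (ltW x0)).
  have : expR 1 <= x / r 0%N.
    by rewrite ler_pdivlMr ?(admissible_r_gt0 _ _ _ adm) // mulrC.
  lra.
have M0 : 0 < max_modulus f x by rewrite (lt_trans (expR_gt0 1)).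
have lnM_gt1 : 1 < ln (max_modulus f x) by rewrite -ltr_expR lnK.
have lnx : 0 < ln x by exact: ln_gt0.
by split=> //; rewrite !lne_EFin ?(lt_trans ltr01 lnM_gt1) // dive_posE.
Qed.

(** As log M(x) <= C x^(1/p), the ratio log log M(x) / log x is at most
   log C / log x + 1/p. *)
Lemma infinite_product_order0 : growth_order f = 0%E.
Proof.
rewrite /growth_order limf_esupE; apply/eqP; rewrite eq_le; apply/andP; split.
  apply/lee_addgt0Pr => e e0; rewrite add0e.
  have [C C0 MC] : exists2 C, 0 < C & forall x, 0 <= x ->
      max_modulus f x <= expR (C * x `^ (Num.truncn (2 / e)).+1%:R^-1).
    exact: max_modulus_le.
  set p := _.+1 in MC.
  have pe : p%:R^-1 <= e / 2.
    rewrite -[leRHS]invrK lef_pV2 ?posrE ?invr_gt0 ?divr_gt0 //.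
    by rewrite invf_div ltW // truncnS_gt.
  pose X := Num.max (r 0%N * expR 1) (expR (2 * ln C / e)).
  apply: ge_ereal_inf; exists (ereal_sup ((fun x : R =>
      (lne (lne (max_modulus f x)%:E) / lne x%:E)%E) @` [set x | X < x])).
    by exists [set x | X < x] => //; exists X; split; [exact: num_real | ].
  apply: ge_ereal_sup => _ [x /= Xx <-].
  have /andP[rx Cx] : (r 0%N * expR 1 <= x) && (expR (2 * ln C / e) <= x).
    by rewrite -ge_max ltW.
  have [lnx lnM_gt1 ->] := growth_ratioE _ rx.
  have x0 : 0 < x by apply: lt_le_trans Cx; exact: expR_gt0.
  have lnM_le : ln (max_modulus f x) <= C * x `^ p%:R^-1.
    rewrite -ler_expR lnK; first exact: MC (ltW x0).
    by rewrite posrE (lt_le_trans ltr01) //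
      (le_trans _ (max_modulus_ge_linear _ (ltW x0))) // lerDl divr_ge0 ?ltW // (admissible_r_gt0 _ _ _ adm).
  have lnlnM : ln (ln (max_modulus f x)) <= ln C + p%:R^-1 * ln x.
    rewrite -ln_powR -lnM ?posrE ?powR_gt0 //.
    by rewrite ler_ln ?posrE ?mulr_gt0 ?powR_gt0 // (lt_trans ltr01).
  rewrite lee_fin ler_pdivrMr //; apply: (le_trans lnlnM).
  have : 2 * ln C / e <= ln x by rewrite -ler_expR lnK.
  rewrite ler_pdivrMr // => lnC.
  have : p%:R^-1 * ln x <= e / 2 * ln x by rewrite ler_wpM2r // ltW.
  lra.
apply: le_ereal_inf_tmp => _ [V [X [_ XV]] <-].
pose x := Num.max (X + 1) (r 0%N * expR 1).
have [|lnx lnM_gt1 E] := growth_ratioE x; first by rewrite le_max lexx orbT.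
apply: le_ereal_sup_tmp; exists (ln (ln (max_modulus f x)) / ln x)%:E.
  by exists x => //; apply: XV; rewrite /= lt_max ltrDl ltr01.
by rewrite lee_fin divr_ge0 ?(ltW lnx) // ln_ge0 // ltW.
Qed.

End GrowthOrder.

(** * Comparison of the minimum and maximum modulus *)

Section ModulusGap.
Variables (R : realType) (eps r : nat -> R).
Hypothesis adm : admissible eps r.

Let N m := Num.truncn (r m `^ eps m).
Let f := infinite_product eps r.
Let r_gt0 m : 0 < r m := admissible_r_gt0 _ _ _ adm m.
Let N_gt0 m : (0 < N m)%N := exponent_gt0 _ _ _ adm m.

Variables (L : R) (j : nat).
Hypothesis L_gt1 : 1 < L.
Hypothesis r_large : 2 * (2 + L) * ln (r j) <= r j.

(** The radius at which the two moduli are compared. *)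
Let s := r j.+1 `^ L^-1.
(** The number, with multiplicity, of zeros in the closed disc of radius r_j,
   and below it the logarithm of the product of their moduli. *)
Let D : R := \sum_(0 <= m < j.+1) (N m)%:R.
Let B : R := \sum_(0 <= m < j.+1) (N m)%:R * ln (r m).

Lemma ln_r_gt0 m : 0 < ln (r m).
Proof. by apply: ln_gt0; have := admissible_r_ge4 _ _ _ adm m; lra. Qed.

Lemma zero_count_ge1 : 1 <= D.
Proof.
rewrite /D big_nat_recl //= -[leLHS]addr0 lerD ?ler1n //.
by rewrite sumr_ge0.
Qed.

Lemma ln_zero_count_le : ln D <= 2 * ln (r j).
Proof.
have D0 : 0 < D by exact: lt_le_trans zero_count_ge1.
rewrite mulr2n mulrDl mul1r -lnM ?posrE // ler_ln ?posrE ?mulr_gt0 //.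
apply: (@le_trans _ _ (\sum_(0 <= m < j.+1) r j)).
  rewrite /D big_nat [leRHS]big_nat; apply: ler_sum => m /andP[_ mj].
  apply: (le_trans (exponent_le_r _ _ _ adm m)).
  exact: (admissible_r_incr _ _ _ adm).
rewrite sumr_const_nat subn0 -mulr_natl ler_wpM2r ?(ltW (r_gt0 j)) //.
exact: (admissible_r_ge_nat _ _ _ adm).
Qed.

Lemma zero_log_sum_ge0 : 0 <= B.
Proof.
by apply: sumr_ge0 => m _; rewrite mulr_ge0 // ltW // ln_r_gt0.
Qed.

Lemma zero_log_sum_le : B <= D * ln (r j).
Proof.
rewrite /D mulr_suml /B big_nat [leRHS]big_nat.
apply: ler_sum => m /andP[_ mj]; rewrite ler_wpM2l //.
by rewrite ler_ln ?posrE // (admissible_r_incr _ _ _ adm).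
Qed.

Lemma ln_exponent_lt : ln (N j.+1)%:R < ln (r j.+1).
Proof.
rewrite (ln_exponent _ _ _ adm) gtr_pMl ?ln_r_gt0 //.
exact: (admissible_eps_lt1 _ _ _ adm).
Qed.

Lemma ln_comparison_radius : ln s = ln (r j.+1) / L.
Proof. by rewrite /s ln_powR mulrC. Qed.

Lemma comparison_radius_gt : r j < s.
Proof.
have s0 : 0 < s by rewrite powR_gt0.
rewrite -ltr_ln ?posrE // ln_comparison_radius ltr_pdivlMr; last first.
  by rewrite (lt_trans ltr01).
apply: le_lt_trans ln_exponent_lt.
apply: le_trans (r_le_ln_exponent _ _ _ adm j).
have := ln_r_gt0 j; move: L_gt1 r_large; nra.
Qed.

(** The factors whose zeros lie in the closed disc of radius r_j suffice for this
   bound. *)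
Lemma max_modulus_ge_expR : expR (D * ln s - B) <= max_modulus f s.
Proof.
have s0 : 0 < s by rewrite powR_gt0.
apply: le_trans (max_modulus_ge _ _ _ adm _ j.+1 (ltW s0)).
rewrite /D /B mulr_suml -sumrB expR_sum; apply: ler_prod => m _.
rewrite expR_ge0 /= -mulrBr expRM_natl lerXn2r ?nnegrE ?expR_ge0 //.
  by rewrite addr_ge0 // divr_ge0 // ltW.
rewrite -ln_div ?posrE // lnK ?posrE ?divr_gt0 //.
by rewrite lerDr.
Qed.

(** The smaller zeros contribute at most exp (D log t - B), which increases with t,
   and the zero at r_(j + 1), of multiplicity N, at most exp (- N t / r_(j + 1)),
   which decreases. As u >= log u for u = N t / (r_(j + 1) D), the second
   exponent is at most - D log u, and the terms in log t cancel. *)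
Lemma normc_le_expR t : s < t < r j.+1 ->
  normc (f t%:C%C) <= expR (D * (ln (r j.+1) + ln D - ln (N j.+1)%:R) - B).
Proof.
move=> /andP[st tr].
have t_gt_r : r j < t by exact: lt_trans comparison_radius_gt st.
have t0 : 0 < t by exact: lt_trans t_gt_r.
have factorE m : normc (1 - t%:C%C / (r m)%:C%C) = `|1 - t / r m|.
  by rewrite -normc_real rmorphB rmorphM fmorphV rmorph1.
apply: (cvg_normc_le _ _ _ j.+2 _ (infinite_product_cvg _ _ _ adm _)) => n jn.
pose F m := normc (1 - t%:C%C / (r m)%:C%C) ^+ N m.
have F_ge0 m : 0 <= F m by rewrite exprn_ge0 // normc_ge0.
have -> : normc (partial_product eps r t%:C%C n) = \prod_(0 <= m < n) F m.
  exact: normc_partial_product.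
have tail_le1 : \prod_(j.+2 <= m < n) F m <= 1.
  rewrite big_nat; apply: prodr_ile1 => m /andP[jm _].
  rewrite F_ge0 /= /F factorE exprn_ile1 // ger0_norm ?subr_ge0.
    by rewrite gerBl divr_ge0 // ltW.
  rewrite ler_pdivrMr // mul1r (le_trans (ltW tr)) //.
  by rewrite (admissible_r_incr _ _ _ adm) // ltnW.
rewrite (big_cat_nat (leq0n _) jn) big_nat_recr //=.
apply: (@le_trans _ _ ((\prod_(0 <= m < j.+1) F m) * F j.+1)).
  by rewrite ler_piMr // mulr_ge0 // prodr_ge0.
have D0 : 0 < D by exact: lt_le_trans zero_count_ge1.
have NR0 : 0 < (N j.+1)%:R :> R by rewrite ltr0n.
have loss : D * (ln (N j.+1)%:R + ln t - ln (r j.+1) - ln D) <=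
    (N j.+1)%:R * (t / r j.+1).
  set u := (N j.+1)%:R * (t / r j.+1).
  have u0 : 0 < u by rewrite mulr_gt0 // divr_gt0.
  have -> : ln (N j.+1)%:R + ln t - ln (r j.+1) - ln D = ln (u / D).
    rewrite ln_div ?posrE // lnM ?posrE ?divr_gt0 // ln_div ?posrE //.
    by rewrite addrA.
  rewrite mulrC -ler_pdivlMr // ltW // ln_sublinear //.
  by rewrite divr_gt0.
apply: (@le_trans _ _ (expR (D * ln t - B) *
    expR (- ((N j.+1)%:R * (t / r j.+1))))); last first.
  by rewrite -expRD ler_expR; move: loss; lra.
apply: ler_pM => //; first by rewrite prodr_ge0.
- rewrite /D /B mulr_suml -sumrB expR_sum big_nat [leRHS]big_nat.
  apply: ler_prod => m /andP[_ mj].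
  rewrite F_ge0 /= /F factorE -mulrBr expRM_natl.
  rewrite lerXn2r ?nnegrE ?expR_ge0 //.
  rewrite -ln_div ?posrE // lnK ?posrE ?divr_gt0 // ler0_norm.
    by rewrite opprB gerBl.
  rewrite subr_le0 ler_pdivlMr // mul1r (le_trans _ (ltW t_gt_r)) //.
  exact: (admissible_r_incr _ _ _ adm).
- rewrite /F factorE -(mulrN (N _)%:R) expRM_natl lerXn2r ?nnegrE ?expR_ge0 //.
  rewrite ger0_norm; first exact: expR_ge1Dx.
  by rewrite subr_ge0 ler_pdivrMr // mul1r ltW.
Qed.

(** If a < eps / 2, the lower bound of log M(s) makes log m(t) larger than
   (1 - eps / 2) (D log r_(j + 1) - L B). This exceeds the upper bound of
   log m(t), because D log N_(j + 1) / 2 dominates D log D + L B when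
   log r_j is small enough with respect to r_j <= log N_(j + 1). *)
Lemma modulus_gap t a : s < t < s `^ L ->
  ((L * (1 - a))%:E <=
    lne (min_modulus f t)%:E / lne (max_modulus f s)%:E)%E ->
  eps j.+1 / 2 <= a.
Proof.
have L0 : 0 < L by exact: lt_trans L_gt1.
have sL : s `^ L = r j.+1.
  by rewrite /s -powRrM mulVf ?gt_eqF // powRr1 // ltW.
rewrite sL => tr.
have s_gt0 : 0 < s by rewrite powR_gt0.
have t0 : 0 < t by case/andP: tr => + _; exact: lt_trans.
pose lam : R := ln (r j.+1); pose nu : R := ln (N j.+1)%:R.
have nuE : nu = eps j.+1 * lam by exact: (ln_exponent _ _ _ adm).
pose E := D * lam / L - B.
have D1 := zero_count_ge1.
have lnM_ge : E <= ln (max_modulus f s).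
  rewrite -ler_expR lnK; last first.
    by rewrite posrE; apply: lt_le_trans max_modulus_ge_expR; exact: expR_gt0.
  by rewrite /E -mulrA -ln_comparison_radius max_modulus_ge_expR.
have rj0 := ln_r_gt0 j.
have E0 : 0 < E.
  rewrite /E subr_gt0; apply: (le_lt_trans zero_log_sum_le).
  rewrite -mulrA ltr_pM2l; last exact: lt_le_trans D1.
  by rewrite -ln_comparison_radius ltr_ln ?posrE // comparison_radius_gt.
have lnM0 : 0 < ln (max_modulus f s) by exact: lt_le_trans lnM_ge.
have M0 : 0 < max_modulus f s.
  by apply: lt_le_trans max_modulus_ge_expR; exact: expR_gt0.
rewrite (lne_EFin M0) dive_posE // lee_pdivlMr // -EFinM.
have m_le : min_modulus f t <= expR (D * (lam + ln D - nu) - B).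
  apply: le_trans (normc_le_expR _ tr).
  exact: (min_modulus_le _ _ _ _ (ltW t0)).
have [m0|m0] := leP (min_modulus f t) 0.
  by rewrite le0_lneNy ?lee_fin // leeNy_eq.
rewrite lne_EFin // lee_fin => gap.
have lnm : ln (min_modulus f t) <= D * (lam + ln D - nu) - B.
  by rewrite -ler_expR lnK.
rewrite leNgt; apply/negP => a_small.
have eps1 := admissible_eps_lt1 _ _ _ adm j.+1.
have eps0 := admissible_eps_gt0 _ _ _ adm j.+1.
have : L * (1 - eps j.+1 / 2) * E < L * (1 - a) * ln (max_modulus f s).
  apply: (@lt_le_trans _ _ (L * (1 - a) * E)).
    by rewrite ltr_pM2r // ltr_pM2l //; lra.
  by rewrite ler_wpM2l // mulr_ge0 // ?ltW //; lra.
move=> /lt_le_trans /(_ gap) /lt_le_trans /(_ lnm).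
apply/negP; rewrite -leNgt.
have -> : L * (1 - eps j.+1 / 2) * E =
    D * lam - D * nu / 2 - L * B + eps j.+1 / 2 * (L * B).
  by rewrite /E nuE; field; rewrite gt_eqF.
have epsB : 0 <= eps j.+1 / 2 * (L * B).
  by rewrite !mulr_ge0 ?zero_log_sum_ge0 ?ltW // divr_gt0.
have LB : L * B <= L * (D * ln (r j)) by rewrite ler_wpM2l ?zero_log_sum_le // ltW.
have D0 : 0 <= D by exact: le_trans D1.
have DD : D * ln D <= D * (2 * ln (r j)) by rewrite ler_wpM2l // ln_zero_count_le.
have Dnu : D * (2 * (2 + L) * ln (r j)) <= D * nu.
  rewrite ler_wpM2l //; apply: le_trans r_large _.
  exact: (r_le_ln_exponent _ _ _ adm).
by have B0 := zero_log_sum_ge0; lra.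
Qed.

End ModulusGap.

(** * Failure of regularity of the minimum modulus along orbits *)

Section NoRegularMinimumModulus.
Variables (R : realType) (eps r : nat -> R).
Hypothesis adm : admissible eps r.

Let f := infinite_product eps r.
Let r_gt0 m : 0 < r m := admissible_r_gt0 _ _ _ adm m.

Section Orbit.
Variables (R1 L : R).
Hypotheses (R1_gt0 : 0 < R1) (L_gt1 : 1 < L).

Let s j := r j.+1 `^ L^-1.

Lemma orbit_ge0 n : 0 <= max_modulus_orbit f R1 n.
Proof.
elim: n => [|n IHn]; first exact: ltW.
rewrite /max_modulus_orbit iterS -/(max_modulus_orbit f R1 n).
apply: le_trans (max_modulus_ge _ _ _ adm _ 0 IHn).
by rewrite /majorant_product big_nil.
Qed.

Lemma comparison_radius_le j : s j <= r j.+1.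
Proof.
apply: ler1_powR; first exact: (admissible_r_ge1 _ _ _ adm).
by rewrite invf_le1 ?ltW // (lt_trans ltr01).
Qed.

(** M(x) <= exp (C x^(1/2)), while r_(j + 2) >= exp (r_(j + 1)). *)
Lemma max_modulus_lt_next_radius : exists X, forall j x, X < r j.+1 ->
  0 <= x -> x <= s j -> max_modulus f x < s j.+1.
Proof.
have L0 : 0 < L by exact: lt_trans L_gt1.
have [//|C C0 MC] := max_modulus_le _ _ _ adm 2.
exists ((C * L) ^+ 2) => j x rX x0 xs.
set y := r j.+1 `^ 2^-1; have y0 : 0 < y by rewrite powR_gt0.
have yE : r j.+1 = y ^+ 2.
  by rewrite -powR_mulrn ?powR_ge0 // -powRrM mulVf ?powRr1 ?ltW.
apply: (le_lt_trans (MC x x0)).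
apply: (@le_lt_trans _ _ (expR (C * y))).
  rewrite ler_expR ler_pM2l // ge0_ler_powR ?nnegrE ?invr_ge0 ?(ltW (r_gt0 _)) //.
  exact: le_trans xs (comparison_radius_le _).
apply: (@lt_le_trans _ _ (expR (r j.+1 / L))).
  rewrite ltr_expR ltr_pdivlMr // yE expr2 mulrAC ltr_pM2r //.
  have : (C * L) ^+ 2 < y ^+ 2 by rewrite -yE.
  by rewrite ltr_pXn2r ?nnegrE ?mulr_ge0 ?ltW.
rewrite expRM ge0_ler_powR ?nnegrE ?invr_ge0 ?expR_ge0 ?(ltW (r_gt0 _)) ?(ltW L0) //.
apply: (le_trans (expR_r_le_exponent _ _ _ adm j.+1)).
exact: (exponent_le_r _ _ _ adm).
Qed.

(** From some rank on, the comparison radii lie in the orbit intervals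
   [R_n, R_(n + 1)), and in distinct ones: if R_n is at most the j-th of these
   radii, then R_(n + 1) = M(R_n) is less than the next one. The index nu j is
   the least n for which R_(n + 1) exceeds the j-th radius. *)
Lemma orbit_index :
  max_modulus_orbit f R1 n @[n --> \oo] --> +oo ->
  exists (K : nat) (nu : nat -> nat), forall j, (K <= j)%N ->
    [/\ 2 * (2 + L) * ln (r j) <= r j,
        (nu j < nu j.+1)%N &
        max_modulus_orbit f R1 (nu j) <= s j < max_modulus_orbit f R1 (nu j).+1].
Proof.
move=> Roo; have L0 : 0 < L by exact: lt_trans L_gt1.
have [X XP] := max_modulus_lt_next_radius.
pose Y := Num.max R1 (Num.max X ((2 * (2 * (2 + L))) ^+ 2)).
pose K := Num.truncn Y.
have r_gtY j : (K <= j)%N -> Y < r j.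
  move=> Kj; apply: lt_le_trans (admissible_r_ge_nat _ _ _ adm j).
  by apply: (lt_le_trans (truncnS_gt _)); rewrite ler_nat ltnS.
have large j : (K <= j)%N ->
    [/\ R1 < r j, X < r j & 2 * (2 + L) * ln (r j) <= r j].
  move=> /r_gtY; rewrite !gt_max => /and3P[? ? /ltW rj]; split => //.
  by apply: linear_ln_le_id => //; rewrite mulr_gt0 // addr_gt0.
have exceeds j : exists n, s j < max_modulus_orbit f R1 n.+1.
  have /cvgryPgt /(_ (s j)) [n _ nP] := Roo.
  by exists n; apply: nP => /=.
pose nu j := ex_minn (exceeds j).
have nu_gt j : s j < max_modulus_orbit f R1 (nu j).+1.
  by rewrite /nu; case: ex_minnP.
have nu_min j n : s j < max_modulus_orbit f R1 n.+1 -> (nu j <= n)%N.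
  by rewrite /nu; case: ex_minnP => m _; apply.
have nu_le j : (K <= j)%N -> max_modulus_orbit f R1 (nu j) <= s j.
  move=> Kj; have := nu_min j; case: (nu j) => [_|n n_min].
    have [R1r _ rj] := large j Kj.
    exact/ltW/(lt_trans R1r)/(comparison_radius_gt _ _ _ adm _ _ L_gt1 rj).
  by rewrite leNgt; apply/negP => /n_min; rewrite ltnn.
exists K, nu => j Kj; have [_ _ rj] := large j Kj.
have [_ Xr rjS] := large j.+1 (leqW Kj).
split => //; last by rewrite nu_le ?nu_gt.
have sjS : s j < s j.+1.
  apply: (le_lt_trans (comparison_radius_le j)).
  exact: (comparison_radius_gt _ _ _ adm _ _ L_gt1 rjS).
rewrite ltn_neqAle nu_min ?andbT; last exact: lt_trans sjS (nu_gt _).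
apply/eqP => nuE; have := nu_gt j.+1; rewrite -nuE ltNge.
by rewrite (ltW (XP j _ Xr (orbit_ge0 _) (nu_le j Kj))).
Qed.

End Orbit.

(** The terms of (a_n) along the increasing sequence of indices nu dominate the
   eps_k / 2, so the convergence of the series of the a_n would imply that of the
   series of the eps_k. *)
Lemma no_regular_minimum_modulus :
  ~ exists (R1 L : R) (a : nat -> R),
    [/\ 0 < R1, 1 < L & forall n, 0 < a n] /\
    [/\ max_modulus_orbit f R1 n @[n --> \oo] --> +oo,
        forall (n : nat) (s : R),
          max_modulus_orbit f R1 n <= s < max_modulus_orbit f R1 n.+1 ->
          exists2 t : R, s < t < s `^ L &
            ((L * (1 - a n))%:E <=
             lne (min_modulus f t)%:E / lne (max_modulus f s)%:E)%E
      & (\sum_(0 <= n <oo) (a n)%:E < +oo)%E].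
Proof.
move=> [R1 [L [a [[R1_gt0 L_gt1 a_gt0] [Roo gap a_fin]]]]].
have [K [nu KP]] := orbit_index _ _ R1_gt0 L_gt1 Roo.
have a_ge0 n : 0 <= a n by exact: ltW.
have [A aA] := nneseries_bounded _ _ a_ge0 a_fin.
have eps_ge0 m : 0 <= eps m by exact/ltW/(admissible_eps_gt0 _ _ _ adm).
have /(nneseries_unbounded _ _ eps_ge0) : (\sum_(0 <= m <oo) (eps m)%:E = +oo)%E.
  by case: adm => -[].
apply; exists (\sum_(0 <= m < K.+1) eps m + 2 * A) => n.
apply: (@le_trans _ _ (\sum_(0 <= m < K.+1 + n) eps m)).
  by rewrite (big_cat_nat (leq0n n) (leq_addl K.+1 n)) /= lerDl sumr_ge0.
rewrite (big_cat_nat (leq0n _) (leq_addr n K.+1)) /= lerD2l.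
have eps_le i : eps (K.+1 + i)%N <= 2 * a (nu (K + i)%N).
  have [rj _ /gap[t st]] := KP _ (leq_addr i K).
  by move=> /(modulus_gap _ _ _ adm _ _ L_gt1 rj _ _ st); rewrite addSn; lra.
rewrite -{1}[K.+1]add0n big_addn addKn.
apply: (@le_trans _ _ (\sum_(0 <= i < n) 2 * a (nu (K + i)%N))).
  by apply: ler_sum => i _; rewrite addnC.
rewrite -mulr_sumr ler_pM2l //; apply: le_trans (aA (nu (K + n)%N)).
apply: (@sum_subsequence_le _ a a_ge0 (fun i => nu (K + i)%N)) => i.
by rewrite addnS; have [] := KP _ (leq_addr i K).
Qed.

End NoRegularMinimumModulus.

Theorem mainTheorem8 (R : realType) :
  (exists eps r : nat -> R, admissible eps r) /\
  forall eps r : nat -> R, admissible eps r ->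
    let f := infinite_product eps r in
    [/\ forall z : R[i], cvgn (partial_product eps r z),
        transcendental_entire f,
        growth_order f = 0%E
      & ~ exists (R1 L : R) (a : nat -> R),
          [/\ 0 < R1, 1 < L & forall n, 0 < a n] /\
          [/\ max_modulus_orbit f R1 n @[n --> \oo] --> +oo,
              forall (n : nat) (s : R),
                max_modulus_orbit f R1 n <= s < max_modulus_orbit f R1 n.+1 ->
                exists2 t : R, s < t < s `^ L &
                  ((L * (1 - a n))%:E <=
                   lne (min_modulus f t)%:E / lne (max_modulus f s)%:E)%E
            & (\sum_(0 <= n <oo) (a n)%:E < +oo)%E]].
Proof.
split; first exact: admissible_exists.
move=> eps r adm f; split.
- exact: partial_product_cvg.
- exact: infinite_product_transcendental.
- exact: infinite_product_order0.
- exact: no_regular_minimum_modulus.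
Qed.
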